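(* Let $X$ be a completely regular Hausdorff space. The following statements hold. (1) $X$ is a $WCF$-space if and only if $\beta X$ is a $WCF$-space. (2) Let $X\subseteq Y\subseteq \beta X$. Then $X$ is a $WCF$-space if and only if $Y$ is a $WCF$-space. (3) $X$ is a $WCF$-space if and only if $\upsilon X$ is a $WCF$-space.
   Context: For a space $X$, $C(X)$ is the ring of real-valued continuous functions on $X$. For $f\in C(X)$, the zero-set of $f$ is $Z(f)=f^{-1}(\{0\})$ and the cozero-set of $f$ is $X\setminus Z(f)$. A completely regular Hausdorff space $X$ is a $WCF$-space if for every two disjoint cozero-sets $A,B$ of $X$ there exist zero-sets $Z_1,Z_2$ of $X$ with $A\subseteq Z_1$, $B\subseteq Z_2$ and $\mathrm{int}\,Z_1\cap \mathrm{int}\,Z_2=\emptyset$. $\beta X$ is the Stone–Čech compactification of $X$ (the compactification in which $X$ is dense and $C^*$-embedded) and $\upsilon X$ is the (Hewitt) realcompactification of $X$ (in which $X$ is dense and $C$-embedded); $X\subseteq \upsilon X\subseteq\beta X$. *)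

(* Defs.v *)
From mathcomp Require Import all_boot all_order all_algebra.
From mathcomp Require Import all_classical all_reals all_analysis.

Set Implicit Arguments.
Unset Strict Implicit.
Unset Printing Implicit Defensive.

Import Order.TTheory GRing.Theory Num.Theory.
Import numFieldNormedType.Exports.

Local Open Scope classical_set_scope.
Local Open Scope ring_scope.

Definition tychonoff_space (T : topologicalType) : Prop :=
  completely_regular_space T /\ hausdorff_space T.

Section Zero_sets.
Variables (R : realType) (T : topologicalType).

Definition zero_set (Z : set T) : Prop :=
  exists2 f : T -> R, continuous f & Z = f @^-1` [set 0].

Definition cozero_set (A : set T) : Prop :=
  exists2 f : T -> R, continuous f & A = ~` (f @^-1` [set 0]).

Definition WCF_space : Prop :=
  tychonoff_space T /\
  forall A B : set T, cozero_set A -> cozero_set B -> A `&` B = set0 ->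
    exists Z1 Z2 : set T,
      [/\ zero_set Z1, zero_set Z2, A `<=` Z1, B `<=` Z2 &
          interior Z1 `&` interior Z2 = set0].

End Zero_sets.

(* Ideals of the ring C(T), represented as sets of functions T -> R all of whose
   members are continuous. *)
Section Ideals_of_C.
Variables (R : realType) (T : topologicalType).

Definition C_ideal (I : set (T -> R)) : Prop :=
  [/\ forall f : T -> R, I f -> continuous f,
      I (cst 0),
      forall f g : T -> R, I f -> I g -> I (f \+ g) &
      forall f g : T -> R, continuous f -> I g -> I (f \* g)].

Definition C_maximal_ideal (M : set (T -> R)) : Prop :=
  [/\ C_ideal M, ~ M (cst 1) &
      forall J : set (T -> R),
        C_ideal J -> ~ J (cst 1) -> M `<=` J -> J = M].

(* The residue field C(T)/M coincides with its canonical copy of R: every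
   continuous function is congruent modulo M to a constant. *)
Definition real_ideal (M : set (T -> R)) : Prop :=
  forall f : T -> R, continuous f -> exists r : R, M (fun x => f x - r).

Definition fixed_ideal (M : set (T -> R)) : Prop :=
  exists x : T, forall f, M f -> f x = 0.

(* The Gillman-Jerison definition: every free maximal ideal is hyper-real. *)
Definition realcompact_space : Prop :=
  tychonoff_space T /\
  forall M : set (T -> R),
    C_maximal_ideal M -> real_ideal M -> fixed_ideal M.

End Ideals_of_C.

Section Extensions.
Variables (R : realType) (X Y : topologicalType) (e : X -> Y).

Definition topological_embedding : Prop :=
  [/\ injective e, continuous e &
      forall U : set X, open U -> exists2 V : set Y, open V & U = e @^-1` V].

Definition dense_embedding : Prop :=
  topological_embedding /\ dense (range e).

Definition C_embedded : Prop :=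
  forall f : X -> R, continuous f ->
    exists2 g : Y -> R, continuous g & f = g \o e.

Definition Cstar_embedded : Prop :=
  forall f : X -> R, continuous f -> bounded_fun f ->
    exists g : Y -> R, [/\ continuous g, bounded_fun g & f = g \o e].

(* Y, with e as inclusion map, is the Stone-Cech compactification of X. *)
Definition is_stone_cech : Prop :=
  [/\ compact [set: Y], hausdorff_space Y, dense_embedding & Cstar_embedded].

(* Y, with e as inclusion map, is the Hewitt realcompactification of X. *)
Definition is_hewitt_realcompactification : Prop :=
  [/\ realcompact_space R Y, dense_embedding & C_embedded].

End Extensions.

(* Main.v *)
Require Import Defs.
From mathcomp Require Import all_boot all_order all_algebra.
From mathcomp Require Import all_classical all_reals all_analysis.

Set Implicit Arguments.
Unset Strict Implicit.
Unset Printing Implicit Defensive.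

Import Order.TTheory GRing.Theory Num.Theory.
Import numFieldNormedType.Exports.

Local Open Scope classical_set_scope.

(** Let X be dense and C*-embedded in Y, with both spaces Tychonoff. Every
zero-set of X is the trace of a zero-set of Y, because it is the zero-set of a
bounded function. By density, an open subset of Y is contained in a closed one
as soon as its trace on X is contained in the trace of the other. Hence
inclusions of cozero-sets in zero-sets, and disjointness of open sets, pass
between X and Y, so X is WCF if and only if Y is. This applies to beta X, to
every Y between X and beta X, and to upsilon X. *)

(** Otherwise [U] minus [C] would be a non-empty open set missing the dense range of [e]. Taking [C]
    empty is how disjointness of open sets is lifted from [X] to [Y]. *)
Lemma dense_open_sub_closed (X Y : topologicalType) (e : X -> Y)
    (U C : set Y) : dense (range e) -> open U -> closed C ->
  e @^-1` U `<=` e @^-1` C -> U `<=` C.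
Proof.
move=> de oU cC UC y Uy; apply: contrapT => nCy.
have [] := de (U `&` ~` C) _ _; first by exists y.
- by apply: openI => //; exact: closed_openC.
- by move=> z [+ [x _ xz]]; rewrite -xz => -[Ux]; apply; exact: UC.
Qed.

Lemma closed_zero_set (R : realType) (T : topologicalType) (Z : set T) :
  zero_set R Z -> closed Z.
Proof.
move=> [f cf ->]; apply: preimage_closed => [x _|]; first exact: cf.
exact: closed_eq.
Qed.

Lemma open_cozero_set (R : realType) (T : topologicalType) (A : set T) :
  cozero_set R A -> open A.
Proof.
move=> [f cf ->]; apply: closed_openC; apply: (@closed_zero_set R).
by exists f.
Qed.

(** The truncation of [|f|] at 1 vanishes exactly where [f] does. Boundedness is what makes
    C*-embedding applicable to zero-sets. *)
Lemma zero_set_bounded (R : realType) (T : topologicalType) (Z : set T) :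
  zero_set R Z ->
  exists f : T -> R, [/\ continuous f, bounded_fun f & Z = f @^-1` [set 0%R]].
Proof.
move=> [f cf ->]; exists (fun x => Num.min `|f x| 1)%R; split.
- move=> x; apply: (@continuous_min R T (fun x => `|f x|)%R (cst 1%R)).
    apply: (@continuous_comp _ _ _ f (fun y : R => `|y|%R)); first exact: cf.
    exact: norm_continuous.
  exact: cst_continuous.
- exists 1%R; split => // M M1 x _ /=.
  rewrite ger0_norm ?le_min ?normr_ge0 ?ler01//.
  by rewrite (le_trans _ (ltW M1))// ge_min lexx orbT.
- apply/seteqP; split => x /=; first by move->; rewrite normr0 min_l.
  by case: leP => [_ /normr0_eq0//|_ /eqP]; rewrite oner_eq0.
Qed.

Lemma Cstar_embedded_zero_set (R : realType) (X Y : topologicalType)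
    (e : X -> Y) (Z : set X) : Cstar_embedded R e -> zero_set R Z ->
  exists2 W : set Y, zero_set R W & Z = e @^-1` W.
Proof.
move=> Ce /zero_set_bounded [f [cf bf ->]].
have [g [cg _ ->]] := Ce _ cf bf.
by exists (g @^-1` [set 0%R]) => //; exists g.
Qed.

Lemma zero_set_preimage (R : realType) (X Y : topologicalType)
    (e : X -> Y) (W : set Y) : continuous e -> zero_set R W ->
  zero_set R (e @^-1` W).
Proof.
move=> ce [g cg ->]; exists (g \o e) => // x.
by apply: continuous_comp; [exact: ce|exact: cg].
Qed.

Lemma cozero_setC (R : realType) (T : topologicalType) (A : set T) :
  cozero_set R A <-> zero_set R (~` A).
Proof.
split=> -[f cf fA]; exists f => //; first by rewrite fA setCK.
by rewrite -fA setCK.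
Qed.

Section Dense_Cstar_embedding.
Variables (R : realType) (X Y : topologicalType) (e : X -> Y).
Hypotheses (de : dense_embedding e) (Ce : Cstar_embedded R e).

Lemma WCF_space_dense_Cstar : tychonoff_space Y ->
  WCF_space R X -> WCF_space R Y.
Proof.
have [[_ ce _] dr] := de; move=> tY [_ wX]; split=> // A B cA cB AB0.
have pre D : cozero_set R D -> cozero_set R (e @^-1` D).
  by rewrite !cozero_setC preimage_setC; exact: zero_set_preimage.
have [|Z1 [Z2 [zZ1 zZ2 + +]]] := wX _ _ (pre _ cA) (pre _ cB).
  by rewrite -preimage_setI AB0 preimage_set0.
have [W1 zW1 ->] := Cstar_embedded_zero_set Ce zZ1.
have [W2 zW2 ->] := Cstar_embedded_zero_set Ce zZ2 => AW BW W0.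
have cW1 := closed_zero_set zW1; have cW2 := closed_zero_set zW2.
have oA := open_cozero_set cA; have oB := open_cozero_set cB.
exists W1, W2; split=> //; [exact: dense_open_sub_closed AW|
  exact: dense_open_sub_closed BW|].
(* By continuity, the trace of an interior is an open subset of the trace. So the interiors of [W1]
   and [W2] have disjoint traces, and density makes them disjoint. *)
have ei W : e @^-1` interior W `<=` interior (e @^-1` W).
  rewrite -open_subsetE; first by move=> x; exact: interior_subset.
  by apply: open_comp => [x _|]; [exact: ce|exact: open_interior].
rewrite -subset0; apply: (dense_open_sub_closed dr).
- by apply: openI; exact: open_interior.
- exact: closed0.
- by rewrite preimage_set0 -W0 => x [/ei ? /ei ?].
Qed.

Lemma WCF_space_of_dense_Cstar : tychonoff_space X ->
  WCF_space R Y -> WCF_space R X.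
Proof.
have [[_ ce eo] dr] := de; move=> tX [_ wY]; split=> // A B.
rewrite !cozero_setC => /(Cstar_embedded_zero_set Ce)[A' zA AE].
move=> /(Cstar_embedded_zero_set Ce)[B' zB BE] AB0.
have {}AE : A = e @^-1` (~` A') by rewrite -preimage_setC -AE setCK.
have {}BE : B = e @^-1` (~` B') by rewrite -preimage_setC -BE setCK.
have cA : cozero_set R (~` A') by rewrite cozero_setC setCK.
have cB : cozero_set R (~` B') by rewrite cozero_setC setCK.
have [|W1 [W2 [zW1 zW2 AW BW W0]]] := wY _ _ cA cB.
  rewrite -subset0; apply: (dense_open_sub_closed dr).
  - exact: openI (open_cozero_set cA) (open_cozero_set cB).
  - exact: closed0.
  - by rewrite preimage_set0 -AB0 AE BE => x [].
exists (e @^-1` W1), (e @^-1` W2); split.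
- exact: zero_set_preimage.
- exact: zero_set_preimage.
- by rewrite AE => x /AW.
- by rewrite BE => x /BW.
(* Interiors may grow when passing to traces, so [W0] cannot simply be pulled back. Instead the
   common interior in [X] is the trace of an open [V], and density puts [V] inside both closed sets
   [W1] and [W2], hence inside their disjoint interiors. *)
have [V oV VE] := eo (interior (e @^-1` W1) `&` interior (e @^-1` W2))
  (openI (@open_interior _ _) (@open_interior _ _)).
have VW W : zero_set R W -> e @^-1` V `<=` interior (e @^-1` W) ->
    V `<=` interior W.
  move=> zW VW; rewrite -open_subsetE//.
  apply: (dense_open_sub_closed dr) => //; first exact: closed_zero_set zW.
  by move=> x /VW; exact: interior_subset.
rewrite VE -subset0 => x Vx.
(* Falsity is read as membership of [e x] in the empty subset of [Y], so that [W0] can be rewritten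
   backwards. *)
rewrite -[set0 _]/((set0 : set Y) (e x)) -W0.
by split; apply: VW Vx => //; rewrite -VE => y [].
Qed.

End Dense_Cstar_embedding.

Lemma WCF_space_dense_CstarP (R : realType) (X Y : topologicalType)
    (e : X -> Y) : tychonoff_space X -> tychonoff_space Y ->
  dense_embedding e -> Cstar_embedded R e ->
  WCF_space R X <-> WCF_space R Y.
Proof.
by move=> tX tY de Ce; split; [exact: WCF_space_dense_Cstar Ce tY|
  exact: WCF_space_of_dense_Cstar Ce tX].
Qed.

(** A closed set of [X] is the trace of a closed set of [Y], so separating functions, like
    separating open sets, pull back along [e]. *)
Lemma tychonoff_embedding (R : realType) (X Y : topologicalType) (e : X -> Y) :
  topological_embedding e -> tychonoff_space Y -> tychonoff_space X.
Proof.
move=> [ie ce eo] [crY hY]; split.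
- move=> a B cB nBa; have [V oV VE] := eo _ (closed_openC cB).
  have Vea : V (e a) by rewrite -[V _]/((e @^-1` V) a) -VE.
  have /(uniform_separatorP (R := R))[f [cf f01 fa fV]] :=
    crY (e a) (~` V) (open_closedC oV) (fun nV => nV Vea).
  apply/(uniform_separatorP (R := R)); exists (f \o e); split.
  + by move=> x; apply: continuous_comp; [exact: ce|exact: cf].
  + by move=> _ [x _ <-]; apply: f01; exists (e x).
  + by move=> _ [x -> <-]; apply: fa; exists (e a).
  + move=> _ [x Bx <-]; apply: fV; exists (e x) => // Vx.
    by have : (~` B) x by rewrite VE.
- move: hY; rewrite !open_hausdorff => hY x y xy.
  have [|[U V] /= [Ux Vy] [oU oV UV0]] := hY (e x) (e y).
    by apply: contra_neq xy; exact: ie.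
  exists (e @^-1` U, e @^-1` V) => /=.
    by rewrite !inE; split; [move: Ux|move: Vy]; rewrite inE.
  split; [by apply: open_comp => [z _|//]; exact: ce..|].
  by rewrite -preimage_setI; move/eqP: UV0 => ->; rewrite preimage_set0.
Qed.

Lemma tychonoff_compact (R : realType) (T : topologicalType) :
  compact [set: T] -> hausdorff_space T -> tychonoff_space T.
Proof.
move=> cT hT; split=> //.
exact (@normal_completely_regular R T (compact_normal hT cT)
  (hausdorff_accessible hT)).
Qed.

Lemma set_val_embedding (T : topologicalType) (Y : set T) :
  topological_embedding (set_val : set_type Y -> T).
Proof.
split; [exact: val_inj|exact: initial_continuous|].
by move=> _ [V oV <-]; exists V.
Qed.

(** This turns an intermediate set [Y] into a space of its own that receives [X]. *)
Lemma corestrict_set_val (T S : Type) (Y : set S) (e : T -> S) :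
  range e `<=` Y -> exists e' : T -> set_type Y, e = set_val \o e'.
Proof.
by move=> eY; exists (fun x => SigSub (mem_set (eY (e x) (imageT e x)))).
Qed.

Section Corestriction.
Variables (X T : topologicalType) (Y : set T) (e : X -> set_type Y).

Lemma dense_embedding_corestrict :
  dense_embedding (set_val \o e) -> dense_embedding e.
Proof.
move=> [[ie ce eo] de]; split; first split.
- by move=> x y xy; apply: ie => /=; rewrite xy.
- apply/continuousP => _ [V oV <-].
  by move/continuousP: ce; apply.
- move=> U /eo [V oV ->]; exists (set_val @^-1` V) => //.
  by exists V.
- move=> O [y Oy] [V oV VE]; have [] := de V _ oV.
    by exists (set_val y); rewrite -[V _]/((set_val @^-1` V) y) VE.
  move=> z [+ [x _ xz]]; rewrite -xz => Vx.
  by exists (e x); split=> //; rewrite -VE.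
Qed.

(** An extension to [T] restricts to [Y] with the same bound. *)
Lemma Cstar_embedded_corestrict (R : realType) :
  Cstar_embedded R (set_val \o e) -> Cstar_embedded R e.
Proof.
move=> Ce f cf bf; have [g [cg [M [Mr bg]] ->]] := Ce f cf bf.
exists (g \o set_val); split=> //.
- by move=> y; apply: continuous_comp; [exact: initial_continuous|exact: cg].
- by exists M; split=> // N MN y _; exact: (bg N MN (set_val y)).
Qed.

End Corestriction.

(* The extension of a bounded [f] is truncated at a bound of [f]. *)
Lemma C_embedded_Cstar (R : realType) (X Y : topologicalType) (e : X -> Y) :
  C_embedded R e -> Cstar_embedded R e.
Proof.
move=> Ce f cf [M [Mr bf]]; have [g cg gE] := Ce f cf.
(* [bounded_fun] only bounds [f] by numbers strictly above [M], hence the added 1; the absolute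
   value ensures that [- N] is at most [N]. *)
pose N := (`|M| + 1)%R.
have N0 : (0 <= N)%R by rewrite addr_ge0.
have fN x : (`|f x| <= N)%R.
  by apply: (bf N) => //; rewrite /N (le_lt_trans (ler_norm M))// ltrDl.
exists (fun y => Num.max (- N) (Num.min (g y) N))%R; split.
- move=> y.
  apply: (@continuous_max R Y (cst (- N)%R) (fun y => Num.min (g y) N)).
    exact: cst_continuous.
  apply: (@continuous_min R Y g (cst N)); first exact: cg.
  exact: cst_continuous.
- exists N; split; first exact: num_real.
  move=> K NK y _ /=; apply: (le_trans _ (ltW NK)).
  by rewrite ler_norml le_max lexx/= ge_max ge_min lexx orbT andbT (ge0_cp N0).
- apply/funext => x /=; rewrite -[g (e x)]/((g \o e) x) -gE.
  by have := fN x; rewrite ler_norml => /andP[fl fr]; rewrite min_l// max_r.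
Qed.

Unset Implicit Arguments.

Theorem corollary3p14 (R : realType) (X : topologicalType)
    (crX : completely_regular_space X) (hX : hausdorff_space X) :
  [/\ forall (bX : topologicalType) (e : X -> bX),
        is_stone_cech R e -> (WCF_space R X <-> WCF_space R bX),
      forall (bX : topologicalType) (e : X -> bX), is_stone_cech R e ->
        forall Y : set bX, range e `<=` Y ->
          (WCF_space R X <-> WCF_space R (set_type Y)) &
      forall (uX : topologicalType) (e : X -> uX),
        is_hewitt_realcompactification R e ->
          (WCF_space R X <-> WCF_space R uX)].
Proof.
have tX : tychonoff_space X by [].
split=> [bX e [cb hb de Ce]|bX e [cb hb + +] Y|uX e [[tu _] de Ce]].
- by apply: WCF_space_dense_CstarP de Ce => //; exact: (tychonoff_compact R).
(* Here [Y] is Tychonoff as a subspace of the compact Hausdorff space [bX], and [e'] inherits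
   density and C*-embedding from the map into [bX]. *)
- move=> + + /corestrict_set_val[e' eE]; rewrite {e}eE => de Ce.
  have tb := tychonoff_compact R cb hb.
  apply: (@WCF_space_dense_CstarP R X _ e') => //.
  + by apply: (tychonoff_embedding R) tb; exact: set_val_embedding.
  + exact: dense_embedding_corestrict.
  + exact: Cstar_embedded_corestrict.
(* The Tychonoff property of [uX] is part of its realcompactness. *)
- by apply: WCF_space_dense_CstarP de (C_embedded_Cstar Ce).
Qed.
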